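(* Let $p\in(0,1)$ be fixed. Then with high probability $$ \mathrm{sat}\left(G\left(n,p\right),C_4\right)\geqslant\frac{3}{2} n(1+o(1)). $$
   Context: $G(n,p)$ is the binomial random graph on vertex set $[n]$ in which each pair of vertices is adjacent independently with probability $p$. A property holds with high probability if its probability tends to $1$ as $n\to\infty$; $o(1)$ denotes a function of $n$ tending to $0$. $C_4$ is the cycle on $4$ vertices. For graphs $F,G$, a spanning subgraph $H\subseteq G$ is $F$-saturated in $G$ if $H$ contains no copy of $F$ but adding to $H$ any edge of $G$ not in $H$ creates a copy of $F$; $\mathrm{sat}(G,F)$ is the minimum number of edges of an $F$-saturated graph in $G$. *)

(* Defs.v *)
From HB Require Import structures.
From mathcomp Require Import all_boot all_order all_algebra.
From mathcomp Require Import all_classical all_reals all_analysis.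
Set Implicit Arguments. Unset Strict Implicit. Unset Printing Implicit Defensive.
Import Order.TTheory GRing.Theory Num.Theory.
Local Open Scope ring_scope.

(* Graphs on vertex set 'I_n: an edge {i,j} is encoded by the ordered pair
   (i,j) with i < j; a graph is a subset of [pairs n]. *)
Definition pairs (n : nat) : {set 'I_n * 'I_n} :=
  [set e : 'I_n * 'I_n | (e.1 < e.2)%N].

Definition adj (n : nat) (H : {set 'I_n * 'I_n}) (x y : 'I_n) : bool :=
  ((x, y) \in H) || ((y, x) \in H).

Definition has_C4 (n : nat) (H : {set 'I_n * 'I_n}) : bool :=
  [exists a : 'I_n, exists b : 'I_n, exists c : 'I_n, exists d : 'I_n,
     [&& uniq [:: a; b; c; d], adj H a b, adj H b c, adj H c d & adj H d a]].

Definition C4_saturated (n : nat) (G H : {set 'I_n * 'I_n}) : bool :=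
  [&& H \subset G, ~~ has_C4 H &
      [forall e in G :\: H, has_C4 (e |: H)]].

(* sat(G, C_4): minimum number of edges of a C_4-saturated subgraph of G.
   (A saturated subgraph always exists and has at most #|G| edges, so the
   default value #|G| of the minimum is harmless.) *)
Definition satC4 (n : nat) (G : {set 'I_n * 'I_n}) : nat :=
  \big[minn/#|G|]_(H : {set 'I_n * 'I_n} | C4_saturated G H) #|H|.

Definition Gnp_prob (R : realType) (n : nat) (p : R)
    (A : {set 'I_n * 'I_n} -> bool) : R :=
  \sum_(G : {set 'I_n * 'I_n} | (G \subset pairs n) && A G)
     p ^+ #|G| * (1 - p) ^+ (#|pairs n| - #|G|).

(* Main.v *)
Require Import Defs.
From HB Require Import structures.
From mathcomp Require Import all_boot all_order all_algebra.
From mathcomp Require Import reals.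
From mathcomp Require Import zify lra.
Set Implicit Arguments. Unset Strict Implicit. Unset Printing Implicit Defensive.
Import Order.TTheory GRing.Theory Num.Theory.

(** If [G] has no independent set of more than [s] vertices, every
    [C_4]-saturated [H] in [G] has nearly [3n/2] edges: endpoints of an edge of
    [G] outside [H] are joined by a walk of length 3 in [H].  Call a vertex a hub
    if its [H]-degree is at least [K], and count each edge of [H] twice, giving
    both halves to the non-hub end when the other end is a hub.  A non-hub then
    receives at least 3 unless

    - it has degree at most 2 and no hub neighbour; such a vertex is joined to
      at most [2 K^2] others of this kind by a walk of length 3, so there are at
      most [s (3 + 2 K^2)] of them;
    - it is a leaf attached to a hub; leaves with a common neighbour are
      [G]-independent, so there are at most [s] of them per hub.

    There are at most [2 e(H) / K] hubs, so it suffices that [s << K] and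
    [s K^2 << n].  With high probability [s = O(log n)] is admissible, by the
    first moment bound [n^(s+1) (1 - p)^(s (s+1) / 2)], and [K = (log n)^2] is
    then a valid choice. *)

Lemma card_bigcup_le (I T : finType) (A : {pred I}) (F : I -> {set T}) :
  #|\bigcup_(i in A) F i| <= \sum_(i in A) #|F i|.
Proof.
apply: (big_ind2 (fun (X : {set T}) m => #|X| <= m)) => [|X p Y q hX hY|//].
  by rewrite cards0.
exact: leq_trans (leq_card_setU X Y) (leq_add hX hY).
Qed.

(** * Saturated subgraphs and walks of length 3 *)

Section Saturation.


Variable n : nat.
Implicit Types (G H : {set 'I_n * 'I_n}) (X : {set 'I_n}) (x y u v : 'I_n).

Definition indep G X : bool :=
  [forall x in X, forall y in X, ~~ adj G x y].

Definition nbrs H x : {set 'I_n} := [set y | adj H x y].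

Lemma adjC H x y : adj H x y = adj H y x.
Proof. exact: orbC. Qed.

Lemma adjxx H x : H \subset pairs n -> adj H x x = false.
Proof.
move=> /subsetP sHP; apply/negP => /orP[] /sHP; by rewrite inE /= ltnn.
Qed.

(** An ordered adjacent pair lies in [H] or in the image of [H] under swapping coordinates. *)
Lemma sum_nbrs_le H : \sum_x #|nbrs H x| <= 2 * #|H|.
Proof.
pose sw (e : 'I_n * 'I_n) := (e.2, e.1).
have ->: \sum_x #|nbrs H x| = #|[set e | adj H e.1 e.2]|.
  rewrite -sum1_card (eq_bigl (fun e => true && adj H e.1 e.2)); last first.
    by move=> e; rewrite inE.
  rewrite -(pair_big_dep predT (fun x y => adj H x y) (fun _ _ => 1)) /=.
  by apply: eq_bigr => x _; rewrite -sum1_card; apply: eq_bigl => y; rewrite inE.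
rewrite mul2n -addnn.
apply: leq_trans (_ : #|H :|: sw @: H| <= _).
  apply/subset_leq_card/subsetP => -[x y]; rewrite !inE /adj /= => /orP[-> //|h].
  by apply/orP; right; apply/imsetP; exists (y, x).
apply: leq_trans (leq_card_setU _ _) _; rewrite leq_add2l; exact: leq_imset_card.
Qed.

Lemma adjU1 H u v x y :
  adj ((u, v) |: H) x y =
    [|| adj H x y, (x == u) && (y == v) | (x == v) && (y == u)].
Proof.
rewrite /adj !inE !xpair_eqE; case: (_ \in H); case: ((y, x) \in H);
by rewrite ?orbT //= ?orbF // (andbC (y == u)).
Qed.

(** The other three sides of the cycle contain at most one of [u], [v] each, so they differ from the
    added edge and lie in [H]; together they form the walk. *)
Lemma C4_through_new_edge H u v a b c d :
    uniq [:: a; b; c; d] -> (a == u) && (b == v) || (a == v) && (b == u) ->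
    adj ((u, v) |: H) b c -> adj ((u, v) |: H) c d -> adj ((u, v) |: H) d a ->
  exists x y, [/\ adj H u x, adj H x y & adj H y v].
Proof.
have neqE (x y : 'I_n) : x != y -> ((x == y) = false) * ((y == x) = false).
  by move=> /negPf xy; rewrite (eq_sym y) xy.
rewrite !adjU1 /= !inE !negb_or => /and4P[/and3P[ab ac ad] /andP[bc bd] cd _].
case/orP=> /andP[/eqP ? /eqP ?]; subst a b.
- rewrite !(neqE _ _ ab, neqE _ _ ac, neqE _ _ ad, neqE _ _ bc, neqE _ _ bd).
  rewrite /= ?andbF ?orbF => vc cd' du.
  by exists d, c; split; rewrite adjC.
- rewrite !(neqE _ _ ab, neqE _ _ ac, neqE _ _ ad, neqE _ _ bc, neqE _ _ bd).
  rewrite /= ?andbF ?orbF => uc cd' dv.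
  by exists c, d; rewrite uc cd' dv.
Qed.

(** Some side of the cycle is the added edge, since otherwise the whole cycle lies in [H]; a
    rotation brings that side to the front. *)
Lemma has_C4_add_edge H u v : ~~ has_C4 H -> has_C4 ((u, v) |: H) ->
  exists x y, [/\ adj H u x, adj H x y & adj H y v].
Proof.
move=> nC4 /existsP[a] /existsP[b] /existsP[c] /existsP[d].
case/and5P=> abcd hab hbc hcd hda.
pose new x y := (x == u) && (y == v) || (x == v) && (y == u).
have rot1 (w x y z : 'I_n) : uniq [:: w; x; y; z] -> uniq [:: x; y; z; w].
  by rewrite -(rot_uniq 1).
have [nab|nab] := boolP (new a b); first exact: (C4_through_new_edge abcd nab).
have [nbc|nbc] := boolP (new b c).
  exact: (C4_through_new_edge (rot1 _ _ _ _ abcd) nbc).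
have [ncd|ncd] := boolP (new c d).
  exact: (C4_through_new_edge (rot1 _ _ _ _ (rot1 _ _ _ _ abcd)) ncd).
have [nda|nda] := boolP (new d a).
  exact: (C4_through_new_edge (rot1 _ _ _ _ (rot1 _ _ _ _ (rot1 _ _ _ _ abcd)))
            nda).
case/negP: nC4; apply/existsP; exists a; apply/existsP; exists b.
apply/existsP; exists c; apply/existsP; exists d; rewrite abcd.
move: hab hbc hcd hda; rewrite !adjU1 -/(new a b) -/(new b c) -/(new c d).
by rewrite -/(new d a) (negPf nab) (negPf nbc) (negPf ncd) (negPf nda) !orbF;
  move=> -> -> -> ->.
Qed.

Lemma saturated_walk G H u v : C4_saturated G H -> adj G u v ->
  adj H u v \/ exists x y, [/\ adj H u x, adj H x y & adj H y v].
Proof.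
case/and3P=> _ nC4 /forallP sat uvG.
have [huv|huv] := boolP (adj H u v); [by left | right].
case/norP: huv => uvH vuH.
case/orP: uvG => hG.
  apply: has_C4_add_edge nC4 _.
  by move: (sat (u, v)); rewrite inE uvH hG.
have [|x [y [vx xy yu]]] := @has_C4_add_edge H v u nC4.
  by move: (sat (v, u)); rewrite inE vuH hG.
by exists y, x; split; rewrite adjC.
Qed.

(** Take a maximal [C_4]-free subgraph of [G], starting from the empty graph. *)
Lemma exists_C4_saturated G : exists H, C4_saturated G H.
Proof.
have free0 : (set0 \subset G) && ~~ has_C4 (set0 : {set 'I_n * 'I_n}).
  rewrite sub0set /=; apply/negP => /existsP[a] /existsP[b] /existsP[c].
  by move=> /existsP[d] /and5P[_]; rewrite /adj !inE.
have [H maxH _] := @maxset_exists _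
  (fun H => (H \subset G) && ~~ has_C4 H) set0 free0.
exists H; have /andP[sHG nC4] := maxsetp maxH.
apply/and3P; split=> //; apply/forall_inP => e; rewrite inE => /andP[eH eG].
apply: contraNT eH => nC4e.
have := maxsetsup maxH _ (subsetUr [set e] H); rewrite subUset sub1set eG sHG nC4e.
by move=> /(_ isT) <-; rewrite !inE eqxx.
Qed.

Lemma satC4_ge_saturated G : exists2 H, C4_saturated G H & #|H| <= satC4 G.
Proof.
rewrite /satC4.
apply: (big_ind (fun m => exists2 H, C4_saturated G H & #|H| <= m)).
(* The default value [#|G|] of the minimum is covered by any saturated [H], as [H] lies in [G]. *)
- have [H satH] := exists_C4_saturated G; exists H => //.
  by apply: subset_leq_card; case/and3P: satH.
- by move=> k m Hk Hm; rewrite /minn; case: ifP.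
- by move=> H satH; exists H.
Qed.

(** * Counting edges around hubs *)

Section HubCounting.

Variables (G H : {set 'I_n * 'I_n}) (s K : nat).
Hypotheses (sGP : G \subset pairs n) (satH : C4_saturated G H).
Hypothesis indep_le : forall X, indep G X -> #|X| <= s.

Let sHP : H \subset pairs n.
Proof. by case/and3P: satH => sHG _ _; apply: subset_trans sHG sGP. Qed.

Let hub := [set x | K <= #|nbrs H x|].
Let low := [set x | (#|nbrs H x| <= 2) && (nbrs H x :&: hub == set0)].
Let pendant := [set x | [exists a in hub, nbrs H x == [set a]]].

Lemma card_hub : K * #|hub| <= 2 * #|H|.
Proof.
apply: leq_trans (sum_nbrs_le H).
rewrite (bigID (mem hub)) /=; apply: leq_trans (leq_addr _ _).
rewrite mulnC -sum_nat_const; apply: leq_sum => x; by rewrite inE.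
Qed.

(** A walk of length 3 between two leaves at [a] has both inner vertices equal to [a], so its middle
    edge would be a loop; an [H]-edge between them would also force a loop at [a]. *)
Lemma card_pendant : #|pendant| <= #|hub| * s.
Proof.
apply: leq_trans (_ : #|\bigcup_(a in hub) [set x | nbrs H x == [set a]]| <= _).
  apply/subset_leq_card/subsetP => x; rewrite inE => /exists_inP[a ah xa].
  by apply/bigcupP; exists a; rewrite // inE.
apply: leq_trans (card_bigcup_le _ _) _.
rewrite -sum_nat_const; apply: leq_sum => a _; apply: indep_le.
apply/forall_inP => u; rewrite inE => /eqP ua.
apply/forall_inP => v; rewrite inE => /eqP va.
have adj_u x : adj H u x -> x = a.
  by move=> ux; apply/set1P; rewrite -ua inE.
have adj_v x : adj H v x -> x = a.
  by move=> vx; apply/set1P; rewrite -va inE.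
have aH : adj H v a by have := set11 a; rewrite -va inE.
apply/negP => /(saturated_walk satH)[uv|[x [y [/adj_u -> axy]]]].
  by move: aH; rewrite (adj_u _ uv) adjxx.
by rewrite adjC => /adj_v ya; move: axy; rewrite ya adjxx.
Qed.

Let reach u : {set 'I_n} :=
  u |: (nbrs H u :|:
        \bigcup_(x in nbrs H u) \bigcup_(y in nbrs H x :\: hub) nbrs H y).

(** The 3 counts [u] and its at most two neighbours. On a walk [u], [x], [y], [v], neither [x] (as
    [u] is in [low]) nor [y] (by definition of [reach]) is a hub, so each has at most [K]
    continuations. *)
Lemma card_reach u : u \in low -> #|reach u| <= 3 + 2 * K ^ 2.
Proof.
rewrite inE => /andP[u2 /eqP uhub].
have nhub x : x \notin hub -> #|nbrs H x| <= K.
  by rewrite inE -ltnNge; apply: ltnW.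
rewrite cardsU1 -[3]/(1 + 2) -addnA; apply: leq_add; first exact: leq_b1.
apply: leq_trans (leq_card_setU _ _) _; apply: leq_add => //.
apply: leq_trans (card_bigcup_le _ _) _.
apply: leq_trans (_ : \sum_(x in nbrs H u) K ^ 2 <= _); last first.
  by rewrite sum_nat_const leq_mul2r u2 orbT.
apply: leq_sum => x ux; apply: leq_trans (card_bigcup_le _ _) _.
apply: leq_trans (_ : \sum_(y in nbrs H x :\: hub) K <= _).
  by apply: leq_sum => y; rewrite inE => /andP[/nhub].
rewrite sum_nat_const leq_mul2r; apply/orP; right.
apply: leq_trans (nhub x _); first exact/subset_leq_card/subsetDl.
by apply/negP => xh; have := in_set0 x; rewrite -uhub inE ux xh.
Qed.

(* A maximal [G]-independent subset of [low] dominates [low] in [G], and every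
   [G]-edge inside [low] is closed by a walk that avoids the hubs. *)
Lemma card_low : #|low| <= s * (3 + 2 * K ^ 2).
Proof.
have indep0 : (set0 \subset low) && indep G set0.
  by rewrite sub0set; apply/forall_inP => x; rewrite inE.
have [I maxI _] := @maxset_exists _
  (fun I => (I \subset low) && indep G I) set0 indep0.
have /andP[sIl indI] := maxsetp maxI.
apply: leq_trans (_ : #|\bigcup_(u in I) reach u| <= _); last first.
  apply: leq_trans (card_bigcup_le _ _) _.
  apply: leq_trans (_ : #|I| * (3 + 2 * K ^ 2) <= _); last first.
    by rewrite leq_mul2r indep_le ?orbT.
  rewrite -sum_nat_const; apply: leq_sum => u uI; apply: card_reach.
  exact: (subsetP sIl).
apply/subset_leq_card/subsetP => v vl.
suff [u uI uv] : exists2 u, u \in I & v \in reach u.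
  by apply/bigcupP; exists u.
have [vI|vI] := boolP (v \in I); first by exists v; rewrite // !inE eqxx.
have [u uI uv] : exists2 u, u \in I & adj G u v.
  apply/exists_inP; apply: contraT => /exists_inPn nadj.
  have := maxsetsup maxI _ (subsetUr [set v] I) => vIE.
  case/negP: vI; rewrite -vIE ?setU11 //.
  rewrite subUset sub1set vl sIl /=.
  apply/forall_inP => x /setU1P xI; apply/forall_inP => y /setU1P yI.
  case: xI yI => [->|xI] [->|yI].
  - by rewrite adjxx.
  - by rewrite adjC nadj.
  - exact: nadj.
  - by move/forall_inP: indI => /(_ _ xI) /forall_inP /(_ _ yI).
exists u => //; rewrite in_setU1 in_setU; apply/orP; right; apply/orP.
case: (saturated_walk satH uv) => [uvH|[x [y [ux xy yv]]]]; [left|right].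
  by rewrite inE.
apply/bigcupP; exists x; rewrite ?inE //.
apply/bigcupP; exists y; rewrite !inE ?yv // xy andbT -/hub.
move: vl; rewrite inE => /andP[_ /eqP vhub].
apply/negP => yh; have := in_set0 y; rewrite -vhub !inE yh andbT.
by rewrite adjC yv.
Qed.

(** The summand is the number of halves that [v] receives. The second term counts hub to non-hub
    edges from the non-hub side; exchanging the sums bounds it by the degrees of the hubs. *)
Lemma sum_nonhub_nbrs_le :
  \sum_(v in ~: hub) (#|nbrs H v| + #|nbrs H v :&: hub|) <= 2 * #|H|.
Proof.
apply: leq_trans (sum_nbrs_le H).
rewrite [leqRHS](bigID (mem hub)) /= addnC big_split /=.
apply: leq_add.
  by rewrite leq_eqVlt; apply/orP; left; apply/eqP; apply: eq_bigl => v;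
    rewrite !inE.
rewrite (eq_bigr (fun v => \sum_(a in hub | adj H v a) 1)); last first.
  by move=> v _; rewrite -sum1_card; apply: eq_bigl => a; rewrite !inE andbC.
rewrite (exchange_big_dep (mem hub)) /=; last by move=> v a _ /andP[].
apply: leq_sum => a ah; rewrite sum1_card.
apply/subset_leq_card/subsetP => v; rewrite !inE => /andP[_ /andP[_ ]].
by rewrite adjC.
Qed.

(** Degree at least 3 suffices alone. Otherwise [v] has a hub neighbour, and degree 2 gives 2 + 1,
    while degree 1 would make [v] pendant. *)
Lemma nbrs_weight v : v \notin low -> v \notin pendant ->
  3 <= #|nbrs H v| + #|nbrs H v :&: hub|.
Proof.
move=> vl vp; have [v3|v2] := ltnP 2 #|nbrs H v|.
  exact: leq_trans v3 (leq_addr _ _).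
have [a] : exists a, a \in nbrs H v :&: hub.
  by apply/set0Pn; move: vl; rewrite inE v2.
rewrite inE => /andP[va ah].
have c1 : 0 < #|nbrs H v :&: hub| by apply/card_gt0P; exists a; rewrite inE va.
have [->|v1] := eqVneq #|nbrs H v| 2; first exact: (leq_add (leqnn 2) c1).
case/negP: vp; rewrite inE; apply/exists_inP; exists a => //.
rewrite eq_sym eqEcard sub1set va cards1.
by rewrite -ltnS ltn_neqAle v1.
Qed.

(** The factor [s.+1] pays for each hub together with its at most [s] pendant leaves. *)
Lemma saturated_card_ge :
  3 * n <= 2 * #|H| + 3 * (#|hub| * s.+1 + s * (3 + 2 * K ^ 2)).
Proof.
pose good := ~: hub :\: (low :|: pendant).
have sgood : 3 * #|good| <= 2 * #|H|.
  apply: leq_trans sum_nonhub_nbrs_le.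
  rewrite (big_setID (low :|: pendant)) /=; apply: leq_trans (leq_addl _ _).
  rewrite mulnC -sum_nat_const; apply: leq_sum => v.
  rewrite !inE negb_or -!andbA => /and3P[vl vp _].
  by apply: nbrs_weight; rewrite ?inE.
have : #|[set: 'I_n]| <= #|good| + (#|hub| + (#|low| + #|pendant|)).
  have -> : [set: 'I_n] = good :|: (hub :|: (low :|: pendant)).
    apply/setP => v; rewrite !(in_setT, in_setU, in_setD, in_setC).
    by case: (v \in hub); case: (v \in low); case: (v \in pendant).
  do 3 (apply: leq_trans (leq_card_setU _ _) _; rewrite ?leq_add2l).
  by [].
rewrite cardsT card_ord; have := card_low; have := card_pendant.
rewrite mulnS; lia.
Qed.

End HubCounting.

(** * Deterministic lower bound and choice of the hub threshold *)

(** Multiplying by [K] eliminates the number of hubs through [card_hub] without division. *)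
Lemma saturated_card_bound G H (s K : nat) :
    G \subset pairs n -> C4_saturated G H ->
    (forall X, indep G X -> #|X| <= s) ->
  K * (3 * n) <= K * (2 * #|H|) + 3 * (2 * #|H| * s.+1 + K * s * (3 + 2 * K ^ 2)).
Proof.
move=> sGP satH indep_le.
have := card_hub H K; have := @saturated_card_ge G H s K sGP satH indep_le.
set h := #|[set x | _]|; set L := 3 + _ => h1 h2.
have h3 : K * h * s.+1 <= 2 * #|H| * s.+1 by rewrite leq_mul2r h2 orbT.
have h4 : K * (3 * n) <= K * (2 * #|H| + 3 * (h * s.+1 + s * L)).
  by rewrite leq_mul2l h1 orbT.
rewrite !mulnDr in h4; rewrite !mulnDr.
rewrite !mulnA in h3 h4 *. lia.
Qed.

(** Here [t] stands for a logarithm of [n] and [K = t ^ 2]. After cancelling a factor [t], hubs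
    contribute [3 * (2 * C + 1)] and low vertices [10 * C], whence [16 * C + 3]. *)
Lemma satC4_bound G (C t : nat) :
    G \subset pairs n -> 0 < t -> t ^ 6 <= n ->
    (forall X, indep G X -> #|X| <= C * t.+1) ->
  t * (3 * n) <= t * (2 * satC4 G) + 3 * (16 * C + 3) * n.
Proof.
move=> sGP t0 t6n indep_le.
have [H satH leH] := satC4_ge_saturated G.
apply: leq_trans (_ : t * (2 * #|H|) + 3 * (16 * C + 3) * n <= _); last first.
  by rewrite leq_add2r !leq_mul2l leH !orbT.
(* With [3 * n] or more half-edges the claim is immediate; otherwise this upper bound on the edges
   controls the hub term. *)
have [e_ge|e_lt] := leqP (3 * n) (2 * #|H|).
  by apply: leq_trans (leq_addr _ _); rewrite leq_mul2l e_ge orbT.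
have := saturated_card_bound (t ^ 2) sGP satH indep_le.
set e := 2 * #|H| in e_lt *; set s := C * t.+1.
have s_le : s <= 2 * C * t by rewrite /s; nia.
have t_le_t4 : 3 + 2 * (t ^ 2) ^ 2 <= 5 * t ^ 4.
  rewrite -expnM; have : 0 < t ^ 4 by rewrite expn_gt0 t0.
  by lia.
have low_le : t ^ 2 * s * (3 + 2 * (t ^ 2) ^ 2) <= 10 * C * t * n.
  apply: leq_trans (_ : t ^ 2 * (2 * C * t) * (5 * t ^ 4) <= _).
    by apply: leq_mul => //; rewrite leq_mul2l s_le orbT.
  apply: leq_trans (_ : 10 * C * t * t ^ 6 <= _); last by rewrite leq_mul2l t6n orbT.
  by rewrite (expnD t 2 4); lia.
have hub_le : e * s.+1 <= 3 * n * ((2 * C + 1) * t).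
  by apply: leq_mul; [apply: ltnW | rewrite mulnDl mul1n -addn1 leq_add].
move=> H1; rewrite -(leq_pmul2l t0).
have : t ^ 2 * (3 * n) <=
    t ^ 2 * e + 3 * (3 * n * ((2 * C + 1) * t) + 10 * C * t * n).
  by apply: leq_trans H1 _; rewrite leq_add2l leq_mul2l leq_add.
by rewrite -mulnn; lia.
Qed.

End Saturation.

Local Open Scope ring_scope.

(** * Independent sets of the random graph *)

Lemma leq_ffact_expn n m : (n ^_ m <= n ^ m)%N.
Proof.
by elim: m => // m IH; rewrite ffactnSr expnSr leq_mul // leq_subr.
Qed.

Lemma leq_bin_expn n m : ('C(n, m) <= n ^ m)%N.
Proof.
by rewrite (leq_trans _ (leq_ffact_expn n m)) // -bin_ffact leq_pmulr ?fact_gt0.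
Qed.

(** Grouping subsets by size gives the binomial expansion of [(1 - p + p) ^+ #|Y|]. *)
Lemma sum_subset_weights (R : comNzRingType) (T : finType) (Y : {set T}) (p : R) :
  \sum_(X : {set T} | X \subset Y) p ^+ #|X| * (1 - p) ^+ (#|Y| - #|X|) = 1.
Proof.
rewrite (partition_big (fun X : {set T} => inord #|X| : 'I_#|Y|.+1) predT) //=.
transitivity ((1 - p + p) ^+ #|Y|); last by rewrite subrK expr1n.
rewrite exprDn; apply: eq_bigr => k _.
rewrite -cards_draws -sumr_const; apply: eq_big => [X|X /andP[sXY /eqP <-]].
  rewrite inE; have [sXY|//] := boolP (X \subset Y).
  by rewrite -val_eqE /= inordK ?ltnS ?subset_leq_card.
by rewrite inordK ?ltnS ?subset_leq_card // mulrC.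
Qed.

Section RandomGraph.

Variables (R : realType) (n : nat) (p : R).
Hypotheses (p_ge0 : 0 <= p) (p_le1 : p <= 1).
Implicit Types (G : {set 'I_n * 'I_n}) (A B : {set 'I_n * 'I_n} -> bool)
  (X : {set 'I_n}).

Local Notation weight G := (p ^+ #|G| * (1 - p) ^+ (#|pairs n| - #|G|)).

Let weight_ge0 G : 0 <= weight G.
Proof. by rewrite mulr_ge0 ?exprn_ge0 ?subr_ge0. Qed.

Lemma Gnp_probC A : Gnp_prob p A + Gnp_prob p (fun G => ~~ A G) = 1.
Proof. by rewrite -(sum_subset_weights (pairs n) p) [RHS](bigID A). Qed.

Lemma Gnp_prob_ge0 A : 0 <= Gnp_prob p A.
Proof. by apply: sumr_ge0 => G _; apply: weight_ge0. Qed.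

Lemma Gnp_prob_le1 A : Gnp_prob p A <= 1.
Proof. by rewrite -(Gnp_probC A) lerDl Gnp_prob_ge0. Qed.

Lemma Gnp_prob_union (I : finType) (D : {set I}) A
    (B : I -> {set 'I_n * 'I_n} -> bool) :
    (forall G, G \subset pairs n -> A G -> exists2 i, i \in D & B i G) ->
  Gnp_prob p A <= \sum_(i in D) Gnp_prob p (B i).
Proof.
move=> AB; rewrite /Gnp_prob.
under [X in _ <= X]eq_bigr do rewrite big_mkcondr.
rewrite exchange_big /= [X in X <= _]big_mkcondr; apply: ler_sum => G sG.
have sum_ge0 (P : pred I) : 0 <= \sum_(i in D | P i) (if B i G then weight G else 0).
  by apply: sumr_ge0 => i _; case: ifP.
have [AG|_] := boolP (A G); last first.
  by apply: sumr_ge0 => i _; case: ifP.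
have [i iD BiG] := AB G sG AG.
by rewrite (bigD1 i) //= BiG lerDl sum_ge0.
Qed.

(** The pairs outside [Y] give a common factor, and the remaining weights on [Y] sum to 1. *)
Lemma Gnp_prob_subset (Y : {set 'I_n * 'I_n}) : Y \subset pairs n ->
  Gnp_prob p (fun G => G \subset Y) = (1 - p) ^+ (#|pairs n| - #|Y|).
Proof.
move=> sY; have /(congr1 ( *%R ((1 - p) ^+ (#|pairs n| - #|Y|)))) :=
  sum_subset_weights Y p.
rewrite mulr1 => <-; rewrite mulr_sumr /Gnp_prob.
rewrite (eq_bigl (fun G => G \subset Y)); last first.
  by move=> G; apply/andb_idl => /subset_trans; apply.
apply: eq_bigr => G sGY; rewrite [RHS]mulrCA -exprD; congr (_ * _ ^+ _).
by rewrite addnBA ?subset_leq_card // subnK ?subset_leq_card.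
Qed.

Definition inside X : {set 'I_n * 'I_n} :=
  [set e in pairs n | (e.1 \in X) && (e.2 \in X)].

Lemma card_inside X : (#|X| * #|X|.-1 <= 2 * #|inside X|)%N.
Proof.
pose sw (e : 'I_n * 'I_n) := (e.2, e.1).
suff : (#|setX X X| <= #|X| + (#|inside X| + #|inside X|))%N.
  by rewrite cardsX; case: #|X| => [|m] //=; rewrite mulnS; lia.
pose diag (x : 'I_n) := (x, x).
apply: leq_trans (_ : #|diag @: X :|: (inside X :|: sw @: inside X)| <= _)%N.
  apply/subset_leq_card/subsetP => -[x y] /setXP[xX yX]; rewrite !inE /= xX yX.
  rewrite andbT; case: ltngtP => [//|yx|/val_inj ->].
  - by rewrite orbT.
  - apply/or3P; apply: Or33; apply/imsetP; exists (y, x) => //.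
    by rewrite !inE /= yx xX yX.
  - by apply/or3P; apply: Or31; apply/imsetP; exists y.
apply: leq_trans (leq_card_setU _ _) _; apply: leq_add; first exact: leq_imset_card.
apply: leq_trans (leq_card_setU _ _) _; rewrite leq_add2l; exact: leq_imset_card.
Qed.

Lemma indep_subset G X :
  G \subset pairs n -> indep G X -> G \subset pairs n :\: inside X.
Proof.
move=> /subsetP sG /forall_inP iX; apply/subsetP => -[x y] xyG.
rewrite in_setD sG // andbT inE sG //=; apply/negP => /andP[/iX /forall_inP iXx].
by move=> /iXx; rewrite /adj xyG.
Qed.

Lemma indep_sub_card G X (s : nat) :
  indep G X -> (s <= #|X|)%N -> exists2 X' : {set 'I_n}, #|X'| = s & indep G X'.
Proof.
move=> /forall_inP iX sX.
have sub x : x \in take s (enum X) -> x \in X.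
  by move=> /mem_take; rewrite mem_enum.
exists [set x in take s (enum X)].
  rewrite cardsE (card_uniqP _) ?take_uniq ?enum_uniq // size_take -cardE.
  by case: ltngtP sX.
apply/forall_inP => x; rewrite inE => /sub /iX /forall_inP xX.
by apply/forall_inP => y; rewrite inE => /sub /xX.
Qed.

(** Union bound over the sets of exactly [s.+1] vertices. The square root [r] of [1 - p] turns the
    exponent [s (s+1) / 2] into [s (s+1)], avoiding halves. *)
Lemma Gnp_prob_indep_bound (s : nat) (r : R) A :
    0 <= r -> r ^+ 2 = 1 - p ->
    (forall G, G \subset pairs n ->
      (forall X, indep G X -> (#|X| <= s)%N) -> A G) ->
  1 - (n%:R * r ^+ s) ^+ s.+1 <= Gnp_prob p A.
Proof.
move=> r_ge0 r2 hA.
suff : Gnp_prob p (fun G => ~~ A G) <= (n%:R * r ^+ s) ^+ s.+1.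
  by have := Gnp_probC A; lra.
have r_le1 : r <= 1.
  by rewrite -(@expr_le1 _ 2) // r2 lerBlDr lerDl.
pose D := [set X : {set 'I_n} | #|X| == s.+1].
apply: le_trans (_ : \sum_(X in D) Gnp_prob p
    (fun G => G \subset pairs n :\: inside X) <= _).
  apply: Gnp_prob_union => G sG nA.
  have [X iX sX] : exists2 X, indep G X & (s < #|X|)%N.
    apply/exists_inP; apply: contraT => /exists_inPn le_s.
    by case/negP: nA; apply: hA => // X /le_s; rewrite -leqNgt.
  have [X' X's iX'] := indep_sub_card iX sX.
  by exists X'; [rewrite inE X's | apply: indep_subset].
apply: le_trans (_ : \sum_(X in D) r ^+ (s.+1 * s) <= _).
  apply: ler_sum => X; rewrite inE => /eqP Xs.
  have sin : inside X \subset pairs n by apply/subsetP => e; rewrite inE => /andP[].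
  rewrite Gnp_prob_subset ?subsetDl // cardsD (setIidPr sin).
  rewrite subKn ?subset_leq_card // -r2 -exprM; apply: ler_wiXn2l => //.
  by have := card_inside X; rewrite Xs.
rewrite sumr_const card_draws card_ord exprMn -exprM mulnC -[leLHS]mulr_natl.
rewrite -natrX ler_wpM2r ?exprn_ge0 // ler_nat; exact: leq_bin_expn.
Qed.

End RandomGraph.

(* Asymptotics *)
From mathcomp Require Import all_classical all_reals all_analysis.
Import numFieldNormedType.Exports.
Local Open Scope classical_set_scope.

Lemma cvg_trunc_log (b : nat) : (1 < b)%N -> trunc_log b n @[n --> \oo] --> \oo.
Proof.
move=> b1; apply/cvgnyPge => M; near=> n; apply: trunc_log_max => //.
by near: n; apply: nbhs_infty_ge.
Unshelve. all: by end_near. Qed.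

Lemma exists_exprn_le (R : realType) (r eps : R) :
  0 <= r -> r < 1 -> 0 < eps -> exists C : nat, r ^+ C <= eps.
Proof.
move=> r0 r1 eps0.
have /cvgr0Pnorm_le /(_ _ eps0) [C _ /(_ C (leqnn C))] : r ^+ n @[n --> \oo] --> 0.
  by apply: cvg_expr; rewrite ger0_norm.
by rewrite /= ger0_norm ?exprn_ge0 // => rC; exists C.
Qed.

(* [n < 2 ^ (8 (t + 1))] and [r ^ (C (t + 1)) <= 2 ^ - (9 (t + 1))], so the
   first moment is at most [2 ^ - (t + 1)]; and [t < 2 ^ t] gives [t ^ 8 <= n]. *)
Lemma Gnp_prob_satC4 (R : realType) (p r : R) (n C t : nat) :
    0 <= p -> p <= 1 -> 0 <= r -> r ^+ 2 = 1 - p -> r ^+ C <= 2 ^- 9 ->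
    (0 < t)%N -> (256 ^ t <= n < 256 ^ t.+1)%N ->
  1 - harmonic t <= Gnp_prob p (fun G : {set 'I_n * 'I_n} =>
    (3 / 2) * n%:R * (1 + - (2 * (16 * C + 3))%:R * harmonic t) <= (satC4 G)%:R :> R).
Proof.
move=> p0 p1 r0 r2 rC t0 /andP[tn nt].
have t6n : (t ^ 6 <= n)%N.
  apply: leq_trans tn.
  rewrite (_ : 256 = 2 ^ 8)%N // -expnM mulnC expnM.
  apply: leq_trans (_ : t ^ 8 <= _)%N; first by rewrite leq_pexp2l.
  by rewrite leq_exp2r // ltnW // ltn_expl.
have nr : n%:R * r ^+ (C * t.+1) <= harmonic t.
  rewrite exprM.
  apply: le_trans (_ : (2 ^ (8 * t.+1))%:R * (2 ^- 9) ^+ t.+1 <= _).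
    apply: ler_pM; rewrite ?exprn_ge0 // ?ler_nat.
      by rewrite expnM ltnW.
    by rewrite lerXn2r ?nnegrE ?exprn_ge0 // invr_ge0 exprn_ge0.
  rewrite natrX exprVn -exprM /harmonic /=.
  rewrite (_ : 9 * t.+1 = 8 * t.+1 + t.+1)%N; last lia.
  rewrite exprD invfM mulrA divff ?expf_neq0 // mul1r.
  by rewrite lef_pV2 ?posrE ?exprn_gt0 ?ltr0n // -natrX ler_nat ltnW // ltn_expl.
have h0 : 0 < harmonic t :> R by rewrite /harmonic /= invr_gt0 ltr0n.
have h1 : harmonic t <= 1 :> R.
  by rewrite /harmonic /= invf_le1 ?ltr0n // ler1n.
apply: le_trans (@Gnp_prob_indep_bound R n p p0 p1 (C * t.+1) r _ r0 r2 _).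
  (* The base of the power is at most [harmonic t <= 1], so the power is at most its base. *)
  rewrite lerD2l lerN2 exprS; apply: (le_trans _ nr).
  rewrite ler_piMr ?mulr_ge0 ?exprn_ge0 //.
  rewrite exprn_ile1 ?mulr_ge0 ?exprn_ge0 //.
  exact: le_trans nr h1.
move=> G sG /(satC4_bound sG t0 t6n); set c := (16 * C + 3)%N.
rewrite -(ler_nat R) natrD !natrM => bound.
(* [harmonic t] is [1 / (t + 1)], not [1 / t]; the loss of at most a factor 2 explains the 2 in
   front of [16 * C + 3]. *)
have th : 1 / 2 <= t%:R * harmonic t :> R.
  rewrite /harmonic /= ler_pdivlMr ?ltr0n // -(natr1 t).
  have : 1 <= t%:R :> R by rewrite ler1n.
  by lra.
have cn : 0 <= c%:R * n%:R :> R by rewrite mulr_ge0.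
have cnth : c%:R * n%:R * (1 / 2) <= c%:R * n%:R * (t%:R * harmonic t) :> R.
  by rewrite ler_wpM2l.
have t0R : 0 < t%:R :> R by rewrite ltr0n.
rewrite -(ler_pM2l t0R); move: bound cnth; set h := harmonic t; lra.
Qed.

Theorem theorem3 (R : realType) (p : R) (hp0 : 0 < p) (hp1 : p < 1) :
  exists f : nat -> R,
    f @ \oo --> (0 : R) /\
    (fun n : nat =>
       @Gnp_prob R n p (fun G => (3 / 2) * n%:R * (1 + f n) <= (satC4 G)%:R))
      @ \oo --> (1 : R).
Proof.
pose r := Num.sqrt (1 - p).
have r2 : r ^+ 2 = 1 - p by rewrite sqr_sqrtr // subr_ge0 ltW.
have r1 : r < 1 by rewrite -(@expr_lt1 _ 2) ?sqrtr_ge0 // r2; lra.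
(* [C] depends on [p] alone, so the error term is a constant times [harmonic (t n)]. *)
have [C rC] : exists C : nat, r ^+ C <= 2 ^- 9.
  by apply: exists_exprn_le; rewrite ?sqrtr_ge0 ?invr_gt0 ?exprn_gt0.
pose t n := trunc_log 256 n.
have ht : harmonic (t n) @[n --> \oo] --> (0 : R).
  apply: (cvg_comp t (@harmonic R)); last exact: cvg_harmonic.
  exact: cvg_trunc_log.
exists (fun n => - (2 * (16 * C + 3))%:R * harmonic (t n)); split.
  by rewrite -[0](mulr0 (- (2 * (16 * C + 3))%:R)); apply: cvgMr.
apply: (@squeeze_cvgr _ _ _ _ (fun n => 1 - harmonic (t n)) (fun=> 1)).
- near=> n; apply/andP; split; last by apply: Gnp_prob_le1; exact: ltW.
  apply: (@Gnp_prob_satC4 R p r n C (t n) (ltW hp0) (ltW hp1) (sqrtr_ge0 _) r2 rC).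
    by rewrite trunc_log_gt0 /=; near: n; apply: nbhs_infty_ge.
  by apply: trunc_log_bounds => //; near: n; apply: nbhs_infty_ge.
- by rewrite -[X in _ --> X]subr0; apply: cvgB => //; apply: cvg_cst.
- exact: cvg_cst.
Unshelve. all: by end_near. Qed.
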